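(* Let $(c_n)_{n\ge1}$ be a sequence (of elements of a commutative ring) and let $$y_n=\sum_{k=0}^n\frac{k!}{n!}B_{n,k}(1!c_1,2!c_2,\dots)\quad(n\ge0).$$ For a positive integer $r$, define the convolution sequence $$y_n^{(r)}=\sum_{m_1+\cdots+m_r=n}y_{m_1}\cdots y_{m_r}\quad(n\ge0),$$ the sum over all $r$-tuples of nonnegative integers with $m_1+\cdots+m_r=n$. Then for all $n\ge1$, $$n\,y_n^{(r)}=\sum_{m=1}^n\,[n+m(r-1)]\,c_m\,y_{n-m}^{(r)}.$$
   Context: $B_{n,k}(x_1,x_2,\dots)$ denotes the $(n,k)$-th partial Bell polynomial: $B_{0,0}=1$ and $$B_{n,k}(x_1,x_2,\dots)=\sum \frac{n!}{j_1!j_2!\cdots}\prod_{i\ge1}\Big(\frac{x_i}{i!}\Big)^{j_i},$$ the sum over all tuples of nonnegative integers $(j_1,j_2,\dots)$ with $j_1+j_2+\cdots=k$ and $j_1+2j_2+\cdots=n$. The quantity $\frac{k!}{n!}B_{n,k}(1!c_1,2!c_2,\dots)=\sum\frac{k!}{j_1!j_2!\cdots}\prod_ic_i^{j_i}$ is an integer-coefficient polynomial in the $c_i$. Equivalently, $\sum_{n\ge0}y_nt^n$ is the reciprocal of $1-\sum_{n\ge1}c_nt^n$, and $y_n^{(r)}$ is the coefficient of $t^n$ in its $r$-th power. *)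

(* Defs.v *)
From mathcomp Require Import all_boot all_order all_algebra.
From mathcomp Require Import ring.
From mathcomp Require Import mpoly.

Set Implicit Arguments.
Unset Strict Implicit.
Unset Printing Implicit Defensive.

Import GRing.Theory Num.Theory.
Local Open Scope ring_scope.

(* 'I_n is 0-based: the index i : 'I_n stands for i.+1 everywhere below, so   *)
(* that 'X_i is the variable x_{i+1} and j i is the exponent j_{i+1}.         *)

(* The tuples (j_1, j_2, ...) with j_1 + j_2 + ... = k and                    *)
(* j_1 + 2 j_2 + ... = n satisfy j_i = 0 for i > n and j_i <= n for all i,    *)
(* so they are exactly the following finite functions.                        *)
Definition Bell_index (n k : nat) (j : {ffun 'I_n -> 'I_n.+1}) : bool :=
  (\sum_(i < n) j i == k)%N && (\sum_(i < n) i.+1 * j i == n)%N.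

(* The partial Bell polynomial B_{n,k}; only x_1, ..., x_n occur in it. *)
Definition Bell (n k : nat) : {mpoly rat[n]} :=
  \sum_(j : {ffun 'I_n -> 'I_n.+1} | Bell_index k j)
    (n`!%:R / \prod_(i < n) (j i)`!%:R) *:
      \prod_(i < n) ((i.+1)`!%:R^-1 *: 'X_i) ^+ j i.

(* k!/n! B_{n,k}(1! c_1, 2! c_2, ...) as a polynomial in the c_i; its         *)
(* coefficients are integers by Bell_scaled_int.                              *)
Definition Bell_scaled (n k : nat) : {mpoly rat[n]} :=
  (k`!%:R / n`!%:R) *:
    (Bell n k \mPo [tuple (i.+1)`!%:R *: 'X_i | i < n]).

(* The value at (c_1, c_2, ...) of a polynomial with integer coefficients     *)
(* that is given as a rational polynomial: numq recovers the integer from its *)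
(* image in rat.  Meaningful only when p has integer coefficients.  This is   *)
(* not meval or mmap because those exclude the zero ring.                     *)
Definition int_eval (R : comPzRingType) (n : nat) (c : nat -> R)
    (p : {mpoly rat[n]}) : R :=
  \sum_(m <- msupp p) (numq p@_m)%:~R * \prod_(i < n) c i.+1 ^+ m i.

(* The value c 0 is never used. *)
Definition yseq (R : comPzRingType) (c : nat -> R) (n : nat) : R :=
  \sum_(0 <= k < n.+1) int_eval c (Bell_scaled n k).

(* An r-tuple of nonnegative integers of sum n has all its entries <= n. *)
Definition convolution (R : comPzRingType) (r : nat) (y : nat -> R)
    (n : nat) : R :=
  \sum_(m : {ffun 'I_r -> 'I_n.+1} | (\sum_i m i == n)%N) \prod_i y (m i).

Lemma dvdn_prod_fact (I : Type) (s : seq I) (f : I -> nat) :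
  (\prod_(i <- s) (f i)`! %| (\sum_(i <- s) f i)`!)%N.
Proof.
elim: s => [|a s IHs]; first by rewrite !big_nil.
rewrite !big_cons -(bin_fact (leq_addr (\sum_(i <- s) f i)%N (f a))) addKn.
by rewrite dvdn_mull // dvdn_mul.
Qed.

Lemma Bell_index_dvdn (n k : nat) (j : {ffun 'I_n -> 'I_n.+1}) :
  Bell_index k j -> (\prod_(i < n) (j i)`! %| k`!)%N.
Proof.
by case/andP => /eqP <- _; exact: (dvdn_prod_fact _ (fun i => j i : nat)).
Qed.

Lemma Bell_scaledE (n k : nat) :
  Bell_scaled n k =
  \sum_(j : {ffun 'I_n -> 'I_n.+1} | Bell_index k j)
    (k`! %/ \prod_i (j i)`!)%N%:R *: 'X_[[multinom (j i : nat) | i < n]].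
Proof.
rewrite /Bell_scaled /Bell (raddf_sum (comp_mpoly _)) scaler_sumr.
apply: eq_bigr => j jP.
have fn0 m : m`!%:R != 0 :> rat by rewrite pnatr_eq0 -lt0n fact_gt0.
rewrite /= comp_mpoly_is_linear scalerA rmorph_prod /=; congr (_ *: _).
  rewrite -{1}(divnK (Bell_index_dvdn jP)) natrM -natr_prod; field.
  by rewrite fn0 pnatr_eq0 -lt0n prodn_gt0 // => i; apply: fact_gt0.
rewrite mpolyXE_id; apply: eq_bigr => i _.
rewrite rmorphXn /= comp_mpoly_is_linear comp_mpolyXU -tnth_nth tnth_mktuple.
by rewrite scalerA mulVf // scale1r mnmE.
Qed.

Lemma Bell_scaled_int (n k : nat) : Bell_scaled n k \is a mpolyOver n Num.int.
Proof.
apply/mpolyOverP => m; rewrite Bell_scaledE raddf_sum rpred_sum //= => j _.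
by rewrite mcoeffZ mcoeffX rpredM ?rpred_nat.
Qed.

Lemma int_eval_Bell_scaled (R : comPzRingType) (c : nat -> R) (n k : nat) :
  int_eval c (Bell_scaled n k) =
  \sum_(j : {ffun 'I_n -> 'I_n.+1} | Bell_index k j)
    (k`! %/ \prod_i (j i)`!)%N%:R * \prod_(i < n) c i.+1 ^+ j i.
Proof.
pose X (j : {ffun 'I_n -> 'I_n.+1}) := [multinom (j i : nat) | i < n].
have Xinj : injective X.
  move=> j1 j2 /mnmP eqj; apply/ffunP => i; apply/val_inj.
  by have := eqj i; rewrite !mnmE.
have coefE m : (Bell_scaled n k)@_m =
    (\sum_(j | Bell_index k j && (X j == m))
       (k`! %/ \prod_i (j i)`!)%N)%:R.
  rewrite Bell_scaledE raddf_sum natr_sum [RHS]big_mkcondr; apply: eq_bigr => j _ /=.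
  by rewrite mcoeffZ mcoeffX -/(X j); case: eqP; rewrite ?mulr1 ?mulr0.
have coefX j : Bell_index k j ->
    (Bell_scaled n k)@_(X j) = (k`! %/ \prod_i (j i)`!)%N%:R.
  move=> jP; rewrite coefE (big_pred1 j) // => j'.
  by rewrite (inj_eq Xinj) /=; case: eqP => [->|]; rewrite ?jP ?andbF.
have fact0 j : Bell_index k j -> (0 < k`! %/ \prod_(i < n) (j i)`!)%N.
  move=> /Bell_index_dvdn; rewrite divn_gt0; first exact/dvdn_leq/fact_gt0.
  by rewrite prodn_gt0 // => i; apply: fact_gt0.
rewrite /int_eval.
rewrite (perm_big [seq X j | j in @Bell_index n k]) /=.
  rewrite big_image /=; apply: eq_bigr => j jP.
  rewrite coefX // pmulrn numq_int -pmulrn; congr (_ * _).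
  by apply: eq_bigr => i _; rewrite mnmE.
apply: uniq_perm; first exact: msupp_uniq.
  by rewrite map_inj_uniq ?enum_uniq.
move=> m; apply/idP/imageP => [|[j jP ->]]; last first.
  by rewrite mcoeff_msupp coefX // pnatr_eq0 -lt0n fact0.
rewrite mcoeff_msupp coefE pnatr_eq0 sum_nat_eq0 negb_forall.
by case/existsP=> j; rewrite negb_imply => /andP[/andP[jP /eqP <-] _]; exists j.
Qed.

(* Main.v *)
(** With [C = \sum_(i >= 1) c_i t^i], the multinomial theorem gives
    [Y = \sum_n y_n t^n = \sum_k C ^+ k], so [Y * (1 - C) = 1].
    Differentiating, [(1 - C) * t * (Y ^+ r)^`() = r * t * C^`() * Y ^+ r], and
    the claim is the coefficient of [t ^+ n] in this identity.  Power series
    are replaced by polynomials that are correct up to degree [n], namely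
    [S = \sum_(k <= n) Q ^+ k] with [Q] the truncation of [C];
    [S * (1 - Q) = 1 - Q ^+ n.+1], and the error is divisible by
    [t ^+ n.+1]. *)

Require Import Defs.
From HB Require Import structures.
From mathcomp Require Import all_boot all_order all_algebra.
From mathcomp Require Import ring.

Import GRing.Theory.
Local Open Scope ring_scope.

Section Multinomial.
Variables n B : nat.
Implicit Types j : {ffun 'I_n -> 'I_B.+1}.

(** [inord] sends an out-of-range value to 0, so this is a genuine increment only if [j i < B];
    [incrE] gets this from a bound on the total degree. *)
Definition incr (i : 'I_n) j : {ffun 'I_n -> 'I_B.+1} :=
  [ffun l => inord (j l + (l == i))].

Definition decr (i : 'I_n) j : {ffun 'I_n -> 'I_B.+1} :=
  [ffun l => inord (j l - (l == i))].

Lemma incrE i j l :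
  (\sum_i j i < B)%N -> incr i j l = (j l + (l == i))%N :> nat.
Proof.
move=> ltjB; rewrite ffunE inordK // ltnS.
rewrite (leq_trans _ ltjB) // (bigD1 l) //= -addnS.
by apply: leq_add => //; case: eqP.
Qed.

Lemma decrE i j l : decr i j l = (j l - (l == i))%N :> nat.
Proof. by rewrite ffunE inordK // ltnS leq_subLR (leq_trans (leq_ord (j l))) ?leq_addl. Qed.

Lemma sum_delta (i : 'I_n) : (\sum_(l < n) (l == i))%N = 1%N.
Proof. by rewrite (bigD1 i) //= eqxx big1 // => l /negPf ->. Qed.

Lemma sum_incr i j :
  (\sum_i j i < B)%N -> (\sum_l incr i j l)%N = (\sum_l j l).+1.
Proof.
move=> ltjB; rewrite (eq_bigr _ (fun l _ => incrE i j l ltjB)).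
by rewrite big_split /= sum_delta addn1.
Qed.

Lemma decrK i j : (0 < j i)%N -> incr i (decr i j) = j.
Proof.
move=> ji_gt0; apply/ffunP => l; apply: val_inj; rewrite /= ffunE decrE subnK.
  by rewrite inordK.
by case: eqP => [->|].
Qed.

Lemma incrK i j : (\sum_i j i < B)%N -> decr i (incr i j) = j.
Proof.
by move=> ltjB; apply/ffunP => l; apply: val_inj; rewrite /= decrE incrE // addnK.
Qed.

Lemma prod_fact_decr i j : (0 < j i)%N ->
  (\prod_l (j l)`! = j i * \prod_l (decr i j l)`!)%N.
Proof.
move=> ji_gt0; rewrite (bigD1 i) //= [in RHS](bigD1 i) //= mulnA; congr (_ * _)%N.
  by rewrite decrE eqxx subn1; case: (nat_of_ord (j i)) ji_gt0.
by apply: eq_bigr => l /negPf li; rewrite decrE li subn0.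
Qed.

(** Pascal's rule for multinomial coefficients: after multiplication by
    [\prod_i (j i)]![, the term at]i[becomes]j i * k[!], and the [j i] add up to [k.+1]. *)
Lemma multinomial_rec j k : (\sum_i j i = k.+1)%N ->
  (k.+1`! %/ \prod_i (j i)`! =
   \sum_(i | (0 < j i)%N) (k`! %/ \prod_l (decr i j l)`!))%N.
Proof.
move=> sumj.
have prod_gt0 (f : {ffun 'I_n -> 'I_B.+1}) : (0 < \prod_i (f i)`!)%N.
  by rewrite prodn_gt0 // => i; apply: fact_gt0.
have dvd_decr i : (0 < j i)%N -> (\prod_l (decr i j l)`! %| k`!)%N.
  move=> ji_gt0.
  have -> : k = (\sum_l decr i j l)%N.
    apply: succn_inj; rewrite -sumj -[RHS]addn1 -(sum_delta i) -big_split /=.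
    by apply: eq_bigr => l _; rewrite decrE subnK //; case: eqP => [->|].
  exact: dvdn_prod_fact.
apply/eqP; rewrite -(eqn_pmul2r (prod_gt0 j)) divnK; last first.
  by rewrite -sumj; apply: dvdn_prod_fact.
rewrite big_distrl /= factS -sumj big_distrl (bigID (fun i => (0 < j i)%N)) /=.
rewrite [X in (_ + X)%N]big1 ?addn0; last first.
  by move=> i; rewrite -eqn0Ngt => /eqP ->.
apply/eqP; apply: eq_bigr => i ji_gt0.
by rewrite (prod_fact_decr _ _ ji_gt0) mulnCA divnK // dvd_decr.
Qed.

(** The bound [B] on the exponents is separate from [k], so that the index type stays fixed during
    the induction on [k] and can later be matched with that of [Bell_index]. *)
Lemma multinomial_theorem (R : comPzRingType) (x : 'I_n -> R) k : (k <= B)%N ->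
  (\sum_i x i) ^+ k =
  \sum_(j : {ffun 'I_n -> 'I_B.+1} | (\sum_i j i == k)%N)
    (k`! %/ \prod_i (j i)`!)%N%:R * \prod_i x i ^+ j i.
Proof.
elim: k => [|k IHk] ltkB.
  rewrite expr0 (big_pred1 [ffun=> ord0]) => [|j] /=.
    by rewrite !big1 ?mulr1 // => i _; rewrite ffunE ?expr0.
  apply/idP/eqP => [|->]; last by rewrite big1 // => i _; rewrite ffunE.
  rewrite sum_nat_eq0 => /forallP j0; apply/ffunP => i; apply: val_inj.
  by rewrite ffunE; apply/eqP/j0.
rewrite exprS IHk ?(ltnW ltkB) // mulr_suml.
(* Both sides become a sum over pairs of a tuple [j] of degree [k.+1] and an index [i] in its
   support: on the right by Pascal's rule, on the left by the bijection [incr i], with inverse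
   [decr i]. *)
transitivity (\sum_i \sum_(j : {ffun 'I_n -> 'I_B.+1} |
      (\sum_i j i == k.+1)%N && (0 < j i)%N)
    (k`! %/ \prod_l (decr i j l)`!)%N%:R * \prod_l x l ^+ j l); last first.
  rewrite [RHS](eq_bigr (fun j : {ffun 'I_n -> 'I_B.+1} =>
    \sum_(i | (0 < j i)%N) (k`! %/ \prod_l (decr i j l)`!)%N%:R *
      \prod_l x l ^+ j l)); last first.
    by move=> j /eqP sumj; rewrite (multinomial_rec _ _ sumj) natr_sum mulr_suml.
  by rewrite [RHS](exchange_big_dep xpredT).
apply: eq_bigr => i _; rewrite mulr_sumr.
rewrite [RHS](reindex_onto (incr i) (decr i)); last first.
  by move=> j /andP[_]; apply: decrK.
apply: eq_big => [j|j /eqP sumj]; last first.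
  have ltjB : (\sum_i j i < B)%N by rewrite sumj.
  rewrite incrK // mulrCA; congr (_ * _).
  rewrite (bigD1 i) //= [in RHS](bigD1 i) //= incrE // eqxx addn1 exprS -mulrA.
  by do 2?congr (_ * _); apply: eq_bigr => l /negPf li; rewrite incrE // li addn0.
apply/idP/idP => [/eqP sumj|/andP[/andP[/eqP sumj ji_gt0] /eqP decrj]].
  have ltjB : (\sum_i j i < B)%N by rewrite sumj.
  by rewrite sum_incr // sumj incrK // incrE // !eqxx addn1.
(* The degree of [j] is still unknown, so [incrE] does not apply; the round trip [decrj] replaces
   it. *)
rewrite -eqSS -sumj -addn1 -(sum_delta i) -big_split /=; apply/eqP.
apply: eq_bigr => l _; rewrite -{1}decrj decrE subnK //.
by case: eqP => [->|].
Qed.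

End Multinomial.

Section GeneratingFunction.
Variable R : comNzRingType.
Implicit Types (p q : {poly R}) (c y : nat -> R).

Lemma coef_exp_eq p q n k : (forall i, (i <= n)%N -> p`_i = q`_i) ->
  forall i, (i <= n)%N -> (p ^+ k)`_i = (q ^+ k)`_i.
Proof.
move=> eqpq; elim: k => [|k IHk] i lein; first by rewrite !expr0.
rewrite !exprS !coefM; apply: eq_bigr => l _.
by rewrite eqpq ?IHk ?(leq_trans (leq_subr _ _)) // (leq_trans (leq_ord l)).
Qed.

(** Once [p] is truncated at degree [n], distributing the [r]-fold product yields a sum over exactly
    the functions that index [convolution]. *)
Lemma convolution_coef r y n p : (forall i, (i <= n)%N -> p`_i = y i) ->
  convolution r y n = (p ^+ r)`_n.
Proof.
move=> py; rewrite (@coef_exp_eq p (\sum_(i < n.+1) y i *: 'X^i) n) //; last first.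
  by move=> i lein; rewrite -poly_def coef_poly ltnS lein py.
rewrite -[X in _ ^+ X]card_ord -prodr_const bigA_distr_bigA /= coef_sum.
rewrite /convolution big_mkcond; apply: eq_bigr => m _.
rewrite scaler_prod prodrXr coefZ coefXn eq_sym.
by case: eqP; rewrite ?mulr1 ?mulr0.
Qed.

(* The truncation to degree [n] of [C = \sum_(i >= 1) c i t^i]. *)
Definition cpoly c n : {poly R} := 'X * \poly_(i < n) c i.+1.

Lemma coef_cpoly c n i : (cpoly c n)`_i = if (0 < i <= n)%N then c i else 0.
Proof. by rewrite coefXM coef_poly; case: i. Qed.

Lemma coef_cpoly_exp_lt c n k i : (i < k)%N -> (cpoly c n ^+ k)`_i = 0.
Proof. by move=> ltik; rewrite exprMn coefXnM ltik. Qed.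

(** In the multinomial expansion of [cpoly c n ^+ k], the tuple [j] contributes in degree
    [\sum_i i.+1 * j i]; taking the coefficient of degree [n] imposes the second condition of
    [Bell_index]. *)
Lemma int_eval_Bell_scaled_coef c n k : (k <= n)%N ->
  int_eval c (Bell_scaled n k) = (cpoly c n ^+ k)`_n.
Proof.
move=> lekn; rewrite int_eval_Bell_scaled.
have -> : cpoly c n = \sum_(i < n) c i.+1 *: 'X^(i.+1).
  rewrite /cpoly poly_def mulr_sumr; apply: eq_bigr => i _.
  by rewrite -scalerAr exprS.
rewrite (multinomial_theorem _ _ _ _ _ lekn) coef_sum big_mkcondr /=.
apply: eq_bigr => j _.
rewrite (eq_bigr (fun i : 'I_n => c i.+1 ^+ j i *: 'X^(i.+1 * j i))); last first.
  by move=> i _; rewrite exprZn exprM.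
rewrite scaler_prod prodrXr !mulr_natl coefMn coefZ coefXn eq_sym.
by case: eqP; rewrite ?mulr1 ?mulr0 ?mul0rn.
Qed.

(** Powers beyond the [i]-th vanish in degree [i], so a single polynomial serves all [i <= n]. *)
Lemma yseq_coef c n i : (i <= n)%N ->
  yseq c i = (\sum_(k < n.+1) cpoly c n ^+ k)`_i.
Proof.
move=> lein; rewrite coef_sum -(big_mkord xpredT (fun k => (cpoly c n ^+ k)`_i)).
rewrite (big_cat_nat (n := i.+1)) //= [X in _ + X]big_nat_cond.
rewrite [X in _ + X]big1 ?addr0; last first.
  by move=> k /andP[/andP[ltik _] _]; rewrite coef_cpoly_exp_lt.
rewrite /yseq !big_mkord; apply: eq_bigr => k _.
rewrite int_eval_Bell_scaled_coef ?leq_ord //.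
apply: (@coef_exp_eq _ _ i) => // l leli.
by rewrite !coef_cpoly leli (leq_trans leli lein).
Qed.

Lemma coefXderiv p n : ('X * p^`())`_n = p`_n *+ n.
Proof. by rewrite coefXM; case: n => [|n]; rewrite ?mulr0n // coef_deriv. Qed.

Lemma convolution_yseq_rec c r n : (0 < r)%N ->
  n%:R * convolution r (yseq c) n =
  \sum_(1 <= m < n.+1)
    (n + m * (r - 1))%:R * c m * convolution r (yseq c) (n - m).
Proof.
case: r => // r _; rewrite subn1 /=.
set Q := cpoly c n; set S : {poly R} := \sum_(k < n.+1) Q ^+ k.
have convE i : (i <= n)%N -> convolution r.+1 (yseq c) i = (S ^+ r.+1)`_i.
  move=> lein; apply: convolution_coef => l leli.
  by rewrite (yseq_coef _ n) // (leq_trans leli).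
have defS : S * (1 - Q) = 1 - Q ^+ n.+1.
  by rewrite mulrC -(opprB Q) mulNr /S -subrX1 opprB.
have dS : S^`() * (1 - Q) - S * Q^`() = - (Q^`() * Q ^+ n * n.+1%:R).
  have := congr1 (@deriv R) defS.
  have -> : (S * (1 - Q))^`() = S^`() * (1 - Q) - S * Q^`().
    by rewrite derivM derivB (derivC 1) sub0r mulrN.
  by rewrite derivB (derivC 1) sub0r deriv_exp mulr_natr.
(* This is [dS] times ['X * S ^+ r * r.+1%:R]. The error term has the factor ['X ^+ n.+1]: [n]
   factors come from [Q ^+ n] and one from the multiplier. *)
have eqX : 'X * (S ^+ r.+1)^`() =
    Q * ('X * (S ^+ r.+1)^`()) + 'X * Q^`() * S ^+ r.+1 * r.+1%:R
    - 'X ^+ n.+1 * ((\poly_(i < n) c i.+1) ^+ n * Q^`() * S ^+ r *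
                    n.+1%:R * r.+1%:R).
  rewrite deriv_exp -[_ *+ r.+1]mulr_natr !exprS /=; move: dS.
  rewrite [Q ^+ n]exprMn.
  move: (\poly_(i < n) c i.+1 : {poly R}) => a.
  move: Q^`() S^`() ('X ^+ n) (a ^+ n) (S ^+ r) n.+1%:R r.+1%:R.
  clear convE defS; move: Q S 'X => q s x q' s' xn {}a sr N K dS.
  apply/eqP; rewrite -subr_eq0; apply/eqP.
  transitivity (x * sr * K * (s' * (1 - q) - s * q' + q' * (xn * a) * N)).
    by ring.
  by rewrite dS addNr mulr0.
have := congr1 (fun p => p`_n) eqX.
rewrite coefB coefXnM ltnSn subr0 coefXderiv coefD mulr_natr coefMn !coefM.
rewrite mulr_natl convE // => ->.
rewrite -sumrMnl -big_split /= big_ord_recl !coefXderiv mulr0n mul0r mul0rn addr0.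
rewrite coef_cpoly mul0r add0r big_add1 big_mkord; apply: eq_bigr => i _.
rewrite lift0 !coefXderiv coef_cpoly ltn_ord convE ?leq_subr //=.
(* The summand [n - m] comes from differentiating [S ^+ r.+1], and [m * r.+1] from differentiating
   [Q]. *)
have -> : (n + i.+1 * r = n - i.+1 + i.+1 * r.+1)%N.
  by rewrite mulnS addnA subnK.
rewrite natrD natrM -[_ *+ r.+1]mulr_natl -[_ *+ (_ - _)]mulr_natl.
by rewrite -[_ *+ i.+1]mulr_natl; ring.
Qed.

End GeneratingFunction.

Theorem theorem3p7 (R : comPzRingType) (c : nat -> R) (r : nat) (hr : (0 < r)%N)
    (n : nat) (hn : (1 <= n)%N) :
  n%:R * convolution r (yseq c) n =
  \sum_(1 <= m < n.+1)
    (n + m * (r - 1))%:R * c m * convolution r (yseq c) (n - m).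
Proof.
have [eq10|nz] := eqVneq (1 : R) 0.
  have all0 (x : R) : x = 0 by rewrite -[x]mul1r eq10 mul0r.
  by rewrite [LHS]all0 [RHS]all0.
(* [{poly R}] is only defined over a nontrivial ring. *)
pose R' : comNzRingType := HB.pack (R : Type) (GRing.ComPzRing.class R)
  (GRing.PzSemiRing_isNonZero.Build R nz).
exact: (@convolution_yseq_rec R' c r n hr).
Qed.
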